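(* Let $\tau_0>0$ be fixed (independent of $E$). For almost all $\underline{E}$, $$\lim_{E\downarrow-\infty}\sum_{j=1}^{N_E}\delta_{\lambda_j^{(E)}}=\sum_{j=1}^\infty\delta_{\lambda_j}\qquad\text{vaguely in }\mathcal{M}([0,\infty)),$$ where $\mathcal{M}([0,\infty))$ denotes the space of locally bounded measures on $[0,\infty)$ and $$\{0=\lambda_1<\lambda_2<\lambda_3<\cdots\}=\Big\{\lambda\in\mathbb{C}:\ \sum_{k=1}^\infty\frac{\lambda}{\lambda-x_k}=0\Big\}.$$
   Context: Fix $0<\alpha<1$. Let $\sum_i\delta_{E_i}$ be a Poisson point process on $\mathbb{R}$ with intensity measure $\alpha e^{-\alpha E}\,dE$; almost surely its support is infinite and bounded above, and its points are labelled in decreasing order $E_1>E_2>\cdots$; write $\underline{E}=(E_1,E_2,\dots)$. For $E\in\mathbb{R}$ let $N_E=\max\{i:E_i\ge E\}$ (so a.s. $1\le N_E<\infty$ for all sufficiently small $E$, and $N_E\uparrow\infty$ as $E\downarrow-\infty$). Given a time unit $\tau_0>0$, set $x_i:=\tau_0e^{-E_i}$. Let $\mathbb{L}_E$ be the $N_E\times N_E$ matrix with entries $(\mathbb{L}_E)_{ii}=\frac{(N_E-1)x_i}{N_E}$ and $(\mathbb{L}_E)_{ij}=-\frac{x_i}{N_E}$ for $i\ne j$. Almost surely, the $x_i$ are distinct and $\mathbb{L}_E$ has $N_E$ distinct real eigenvalues, denoted $0=\lambda_1^{(E)}<\lambda_2^{(E)}<\cdots<\lambda_{N_E}^{(E)}$.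 *)

(* Defs.v *)
From HB Require Import structures.
From mathcomp Require Import all_boot all_order all_algebra.
From mathcomp Require Import complex.
From mathcomp Require Import all_classical all_reals all_analysis.
From mathcomp Require Import measurable_realfun.

Set Implicit Arguments.
Unset Strict Implicit.
Unset Printing Implicit Defensive.

Import Order.TTheory GRing.Theory Num.Theory.
Import numFieldNormedType.Exports.

Local Open Scope classical_set_scope.
Local Open Scope ring_scope.

(* Sequences are indexed from 0: the i-th point (i >= 1) is the term
   of index i.-1 here. *)

Section poisson_point_process.
Context {R : realType}.

Definition point_measure (x : nat -> R) : {measure set R -> \bar R} :=
  mseries (fun i => \d_(x i)) 0.

Definition finite_point_measure (s : seq R) : {measure set R -> \bar R} :=
  msum (fun i => \d_(nth 0 s i)) (size s).

Context {d : measure_display} {T : measurableType d}.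
Variable P : probability T R.

(* [poisson_pmf] is not used because it returns 1 for every [k] when the mean
   is 0; the formula below is the Dirac mass at 0 in that case. A variable with
   infinite mean is almost surely infinite. *)
Definition poisson_distributed (N : T -> \bar R) (m : \bar R) : Prop :=
  match m with
  | r%:E => forall k : nat, P [set w | N w = k%:R%:E] =
                            (r ^+ k / k`!%:R * expR (- r))%:E
  | +oo%E => P [set w | N w = +oo%E] = 1%E
  | -oo%E => False
  end.

(* Taking some of the [A i] equal to [setT] gives the product rule for all
   subfamilies. *)
Definition mutually_independent (n : nat) (N : 'I_n -> T -> \bar R) : Prop :=
  forall A : 'I_n -> set (\bar R), (forall i, measurable (A i)) ->
    P (\bigcap_i (N i @^-1` A i)) = (\prod_(i < n) P (N i @^-1` A i))%E.

(* The point process is the random measure [\sum_i \d_(X i)]. *)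
Definition poisson_point_process (X : nat -> {RV P >-> R})
    (mu : set R -> \bar R) : Prop :=
  let count (B : set R) (w : T) := point_measure (fun i => X i w) B in
  (forall B, measurable B -> poisson_distributed (count B) (mu B)) /\
  (forall (n : nat) (B : 'I_n -> set R),
     (forall i, measurable (B i)) -> trivIset setT B ->
     mutually_independent (fun i => count (B i))).

End poisson_point_process.

Section model.
Context {R : realType}.

Definition exp_intensity (alpha : R) (B : set R) : \bar R :=
  (\int[lebesgue_measure]_(t in B) (alpha * expR (- alpha * t))%:E)%E.

(* max {i >= 1 : E_i >= e}, and 0 if there is no maximum. *)
Definition count_above (E : nat -> R) (e : R) : nat :=
  xget 0%N [set n | [/\ (0 < n)%N, e <= E n.-1 &
    forall m, (0 < m)%N -> e <= E m.-1 -> (m <= n)%N]].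

Definition waiting_time (tau0 : R) (E : nat -> R) (i : nat) : R :=
  tau0 * expR (- E i).

Definition trap_matrix (x : nat -> R) (n : nat) : 'M[R]_n :=
  \matrix_(i < n, j < n)
    if i == j then (n%:R - 1) * x i / n%:R else - (x i / n%:R).

(* [A] has [n] distinct eigenvalues, all real, listed by [s] in increasing order
   starting from 0. *)
Definition increasing_spectrum (n : nat) (A : 'M[R]_n) (s : seq R) : Prop :=
  [/\ size s = n, sorted <%R s, head 0 s = 0 &
      forall a, (a \in s) = eigenvalue A a].

(* The value of [z / (z - x k)] at the pole [z = x k] is a junk value, hence the
   first conjunct. *)
Definition limit_spectrum (K : numFieldType) (x : nat -> K) : set K :=
  [set z | (forall k, z != x k) /\
           series (fun k => z / (z - x k)) @ \oo --> (0 : K)].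

Definition complex_limit_spectrum (x : nat -> R) : set (complex R) :=
  @limit_spectrum (complex R) (fun k => (x k)%:C%C).

End model.

Section vague_convergence.
Context {R : realType}.

(* Measures on [0, +oo[ are represented by measures on [R], of which only the
   restriction to [0, +oo[ is considered. *)
Definition locally_bounded_halfline (mu : {measure set R -> \bar R}) : Prop :=
  forall K : set R, compact K -> K `<=` `[0, +oo[ -> (mu K < +oo)%E.

Definition test_function_halfline (f : R -> R) : Prop :=
  {within `[0, +oo[, continuous f} /\
  compact (closure (`[0, +oo[ `&` [set t | f t != 0])).

Definition vague_cvg_halfline (I : Type) (F : set_system I)
    (mu_ : I -> {measure set R -> \bar R}) (mu : {measure set R -> \bar R}) :=
  [/\ forall i, locally_bounded_halfline (mu_ i),
      locally_bounded_halfline mu &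
      forall f, test_function_halfline f ->
        (\int[mu_ i]_(t in `[0%R, +oo[) (f t)%:E)%E @[i --> F] -->
        (\int[mu]_(t in `[0%R, +oo[) (f t)%:E)%E].

End vague_convergence.

(* Main.v *)
Require Import Defs.
From HB Require Import structures.
From mathcomp Require Import all_boot all_order all_algebra.
From mathcomp Require Import complex polyrcf.
From mathcomp Require Import all_classical all_reals all_analysis.
From mathcomp Require Import measurable_realfun.
From mathcomp Require Import ring lra zify.

(** Write [x k = tau0 * expR (- E k)] for the waiting times; almost surely they
    are positive and strictly increasing.  The matrix on [n] sites is the diagonal
    matrix of [x 0, ..., x n.-1] minus a matrix of rank one, so [a] is an
    eigenvalue exactly when [a] is none of the [x k] and [a = 0] or
    [s_n a = 0], where [s_n t = \sum_(k < n) (t - x k)^-1] is the secular function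
    ([trap_eigenvalueP]).  Between two consecutive poles [s_n] decreases from
    [+oo] to [-oo]; it does not vanish outside the range of the poles.  Hence
    the spectrum consists of [0] and of one zero in each of the [n.-1] gaps
    [x k < t < x k.+1] ([trap_spectrumP]).

    Suppose that [\sum_k (x k)^-1] is finite.  Fix a gap and let [n] grow.  Each
    new pole lies to the right of the gap and contributes a negative term, so
    the zero of [s_n] in the gap decreases with [n].  It cannot approach the left
    pole [x k], because the poles to the right of the gap contribute a bounded
    amount altogether ([secular_root_away]).  So it converges inside the open gap,
    and its limit is a zero of [lim s_n] because the [s_n] are Lipschitz on compact
    parts of the gap, uniformly in [n] ([secular_zero_cvg]).  Strict monotonicity
    makes the zero of the limit in the gap unique.  A solution [z] of the limit
    equation is real, since all the numbers [(z - x k)^-1] have an imaginary part of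
    the sign opposite to that of [z].  This identifies the limit spectrum with [0]
    and the limits of the labelled eigenvalues ([complex_limit_spectrumE]).

    The eigenvalue of label [j.+1] exceeds [x j], uniformly in [n], and
    [x j] tends to infinity.  So the integral of a compactly supported continuous
    function against the spectral counting measures is, for all large [n], a sum
    over a fixed finite set of labels, and it converges term by term
    ([integral_trap_spectrum_cvg]).

    The probabilistic input is that [\sum_k (x k)^-1], that is
    [\sum_k expR (E k)], is almost surely finite.  This is where [alpha < 1] enters:
    the points below a level [M] contribute a sum whose mean is the integral of
    [expR t * alpha * expR (- alpha * t)] over [t <= M], which is finite.  The proof
    compares [expR] with a step function that is constant on intervals of
    length one, because the hypothesis gives the law of the number of points in each
    interval ([integral_layer_sum], [ae_summable_exp]). *)

Set Implicit Arguments.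
Unset Strict Implicit.
Unset Printing Implicit Defensive.

Import Order.TTheory GRing.Theory Num.Theory.
Import numFieldNormedType.Exports.

Local Open Scope classical_set_scope.
Local Open Scope ring_scope.

(** * The secular function and its zeros in the gaps *)

Section secular_function.
Context {R : realType}.
Variable x : nat -> R.
Hypothesis x_incr : {homo x : i j / (i < j)%N >-> i < j}.

Definition secular (t : R) : nat -> R := series (fun j => (t - x j)^-1).

Lemma secularS t n : secular t n.+1 = secular t n + (t - x n)^-1.
Proof. by rewrite /secular /series /= big_nat_recr. Qed.

Definition gap (k : nat) (t : R) : Prop := x k < t < x k.+1.

Lemma incr_nondecr i j : (i <= j)%N -> x i <= x j.
Proof. by rewrite leq_eqVlt => /orP[/eqP-> //|/x_incr/ltW]. Qed.

Lemma gap_same_side k s t j : gap k s -> gap k t -> 0 < (s - x j) * (t - x j).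
Proof.
move=> /andP[s1 s2] /andP[t1 t2]; have [jk|kj] := leqP j k.
  by have := incr_nondecr jk => ?; nra.
by have := incr_nondecr kj => ?; nra.
Qed.

Lemma gap_neq k s j : gap k s -> s - x j != 0.
Proof.
move=> gs; have := gap_same_side j gs gs.
by rewrite lt0r mulf_eq0 => /andP[/norP[]].
Qed.

(** The factor of [t - s] is a sum of positive terms when [s] and [t] lie in the
    same gap: monotonicity and the Lipschitz bound both come from this identity. *)
Lemma secular_sub s t n : (forall j, s - x j != 0) -> (forall j, t - x j != 0) ->
  secular s n - secular t n
    = (t - s) * \sum_(0 <= j < n) ((s - x j) * (t - x j))^-1.
Proof.
move=> s0 t0; rewrite /secular /series /= -sumrB mulr_sumr.
by apply: eq_bigr => j _; field; rewrite s0 t0.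
Qed.

(** Only the term of the pole [x 0] is kept, which gives a decrement that does not
    depend on [n] and so survives the passage to the limit. *)
Lemma secular_decr k s t n : (0 < n)%N -> gap k s -> gap k t -> s <= t ->
  secular t n + (t - s) / ((s - x 0%N) * (t - x 0%N)) <= secular s n.
Proof.
move=> n0 gs gt st; rewrite addrC -lerBrDr.
rewrite secular_sub; [|by move=> j; exact: gap_neq gs|by move=> j; exact: gap_neq gt].
apply: ler_wpM2l; first by rewrite subr_ge0.
case: n n0 => // n _; rewrite big_nat_recl //= lerDl.
by apply: sumr_ge0 => j _; rewrite invr_ge0 ltW // (gap_same_side _ gs gt).
Qed.

Lemma secular_inj k s t n : (0 < n)%N -> gap k s -> gap k t ->
  secular s n = secular t n -> s = t.
Proof.
move=> n0; wlog st : s t / s <= t => [th gs gt|gs gt].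
  by case: (leP s t) => [|/ltW] /th; [exact|move=> h /esym /h -> //].
move=> e; apply/eqP; rewrite eq_le st /= -subr_le0.
have := secular_decr n0 gs gt st; rewrite e gerDl.
by rewrite pmulr_lle0 // invr_gt0 (gap_same_side 0 gs gt).
Qed.

(** The numerator of the secular function over the common denominator
    [\prod_(i < n) ('X - (x i)%:P)]: a polynomial, so that the intermediate value
    theorem for polynomials applies up to the poles. *)
Definition secular_num (n : nat) : {poly R} :=
  \sum_(j < n) \prod_(i < n | i != j) ('X - (x i)%:P).

Lemma secular_num_pole n (k : 'I_n) :
  (secular_num n).[x k] = \prod_(i < n | i != k) (x k - x i).
Proof.
rewrite /secular_num horner_sum (bigD1 k) //= [X in _ + X]big1 ?addr0.
  by rewrite horner_prod; apply: eq_bigr => i _; rewrite !hornerE.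
move=> j jk; rewrite horner_prod (bigD1 k) /= 1?eq_sym //.
by rewrite !hornerE subrr mul0r.
Qed.

Lemma secular_numE n t : (forall j : nat, t - x j != 0) ->
  (secular_num n).[t] = secular t n * \prod_(i < n) (t - x i).
Proof.
move=> t0; rewrite /secular /series /= big_mkord mulr_suml horner_sum.
apply: eq_bigr => j _; rewrite [in RHS](bigD1 j) //= mulrA mulVf ?mul1r //.
by rewrite horner_prod; apply: eq_bigr => i _; rewrite !hornerE.
Qed.

(** The values of the numerator at [x k] and [x k.+1] have opposite signs: their
    product is minus a square times a product over the other poles, all of
    which lie on the same side of [x k] and [x k.+1]. *)
Lemma secular_root n k : (k.+1 < n)%N -> exists2 t, gap k t & secular t n = 0.
Proof.
move=> kn; pose k0 := Ordinal (ltnW kn); pose k1 := Ordinal kn.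
have k01 : k0 != k1 by rewrite -val_eqE /= neq_ltn ltnSn.
have lt01 : x k < x k.+1 by exact: x_incr.
have := @poly_ivtoo R (secular_num n) (x k) (x k.+1) (ltW lt01).
case=> [|t].
  rewrite (secular_num_pole k0) (secular_num_pole k1).
  rewrite (bigD1 k1) 1?eq_sym //= [X in _ * X](bigD1 k0) //=.
  rewrite (eq_bigl (fun i => (i != k1) && (i != k0))); last first.
    by move=> i; rewrite andbC.
  rewrite mulrACA -big_split /=.
  rewrite nmulr_rlt0; last by rewrite pmulr_llt0 ?subr_gt0 // subr_lt0.
  apply: prodr_gt0 => i /andP[]; rewrite -!val_eqE /= => ik1 ik0.
  have [ik|ki] := ltnP i k.
    by rewrite mulr_gt0 // subr_gt0 x_incr // ltnW.
  by rewrite nmulr_rgt0 subr_lt0 x_incr //; lia.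
rewrite in_itv /= => gt /rootP; rewrite secular_numE; last by move=> j; exact: (@gap_neq k).
move=> /eqP; rewrite mulf_eq0 => /orP[/eqP ?|/prodf_eq0 [i _]]; first by exists t.
by rewrite (negbTE (gap_neq _ gt)).
Qed.

Lemma pole_locate n t : (0 < n)%N -> (forall j, (j < n)%N -> t != x j) ->
  [\/ t < x 0%N, x n.-1 < t | exists2 k, (k.+1 < n)%N & gap k t].
Proof.
elim: n => // -[_ _ h|n ih _ h] /=.
  have := h 0%N isT; rewrite neq_lt => /orP[]; first by constructor 1.
  by constructor 2.
have [//||t0|tn|[k kn gk]] := ih.
- by move=> j jn; apply: h; rewrite ltnS ltnW.
- by constructor 1.
- have := h n.+1 (ltnSn _); rewrite neq_lt => /orP[tn1|]; last by constructor 2.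
  by constructor 3; exists n => //; apply/andP.
- by constructor 3; exists k => //; rewrite ltnW.
Qed.

(** Left of all the poles every term is negative; the bound by the first one
    is independent of [n]. *)
Lemma secular_left_of_poles n t : (0 < n)%N -> t < x 0%N ->
  secular t n <= (t - x 0%N)^-1.
Proof.
case: n => // n _ t0; rewrite /secular /series /= big_nat_recl //= gerDl.
apply: sumr_le0 => j _; rewrite invr_le0 subr_le0 ltW //.
by apply: lt_le_trans t0 _; exact: incr_nondecr.
Qed.

Lemma secular_root_gap n t : (0 < n)%N -> (forall j, (j < n)%N -> t != x j) ->
  secular t n = 0 -> exists2 k, (k.+1 < n)%N & gap k t.
Proof.
move=> n0 /(pole_locate n0)[t0|tn|//] st.
  by have := secular_left_of_poles n0 t0; rewrite st leNgt invr_lt0 subr_lt0 t0.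
suff : 0 < secular t n by rewrite st ltxx.
case: n n0 tn {st} => // n _ /= tn; rewrite /secular /series /= big_nat_recr //=.
apply: ltr_wpDl; last by rewrite invr_gt0 subr_gt0.
rewrite big_nat_cond; apply: sumr_ge0 => j /[!andbT] /andP[_ jn].
by rewrite invr_ge0 subr_ge0 ltW // (le_lt_trans _ tn) // incr_nondecr // ltnW.
Qed.

End secular_function.

(** * The spectrum of the trap matrix *)

Section trap_spectrum.
Context {R : realType}.
Variable x : nat -> R.
Hypothesis x_incr : {homo x : i j / (i < j)%N >-> i < j}.
Hypothesis x_gt0 : forall i, 0 < x i.

Lemma mul_trap_matrix n (v : 'rV[R]_n) (j : 'I_n) : (0 < n)%N ->
  (v *m trap_matrix x n) 0 j
    = v 0 j * x j - (\sum_(i < n) v 0 i * x i) / n%:R.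
Proof.
move=> n0; have nR0 : n%:R != 0 :> R by rewrite pnatr_eq0 -lt0n.
rewrite mxE mulr_suml (bigD1 j) //= [X in _ - X](bigD1 j) //= mxE eqxx opprD addrA.
congr (_ + _); first by field.
rewrite -sumrN; apply: eq_bigr => i ij; rewrite mxE (negbTE ij).
by field.
Qed.

(** With [c] the coupling [n^-1 * \sum_i v i * x i], the left eigenvector equation
    reads [v j * (x j - a) = c].  At a pole [a = x k] it forces [c = 0], then
    [v = 0].  Elsewhere [v j] is proportional to [(a - x j)^-1], and the
    definition of [c] becomes [\sum_j x j / (a - x j) = - n], which is
    [a * secular x a n = 0]. *)
Lemma trap_eigenvalueP n a : (0 < n)%N ->
  eigenvalue (trap_matrix x n) a <->
  (forall j, (j < n)%N -> a != x j) /\ a * secular x a n = 0.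
Proof.
move=> n0; have nR0 : n%:R != 0 :> R by rewrite pnatr_eq0 -lt0n.
have secE : (forall j, (j < n)%N -> a != x j) ->
    a * secular x a n = n%:R + \sum_(j < n) x j / (a - x j).
  move=> ax; rewrite /secular /series /= big_mkord mulr_sumr.
  transitivity (\sum_(j < n) (1 + x j / (a - x j))).
    apply: eq_bigr => j _; have := ax j (ltn_ord j); rewrite -subr_eq0 => ?.
    by field.
  by rewrite big_split /= sumr_const card_ord.
split=> [/eigenvalueP[v va v0]|[ax as0]]; last first.
  apply/eigenvalueP; exists (\row_j (a - x j)^-1).
    apply/rowP => j; rewrite mul_trap_matrix // !mxE.
    have -> : \sum_(i < n) (\row_j0 (a - x j0)^-1) 0 i * x i = - n%:R.
      rewrite (eq_bigr (fun i : 'I_n => x i / (a - x i))) => [|i _].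
        by move: as0; rewrite secE // => /eqP; rewrite addrC addr_eq0 => /eqP.
      by rewrite mxE mulrC.
    have := ax j (ltn_ord j); rewrite -subr_eq0 => ?; field.
    by apply/andP; split.
  apply/eqP => /rowP /(_ (Ordinal n0)); rewrite !mxE => /eqP.
  by rewrite invr_eq0 subr_eq0 (negbTE (ax _ _)).
pose c := (\sum_(i < n) v 0 i * x i) / n%:R.
have vE j : v 0 j * (x j - a) = c.
  by move/rowP: va => /(_ j); rewrite mul_trap_matrix // mxE -/c => h; lra.
have ax j : (j < n)%N -> a != x j.
  move=> jn; apply/eqP => aj; have c0 : c = 0.
    by rewrite -(vE (Ordinal jn)) aj subrr mulr0.
  have vi (i : 'I_n) : i != Ordinal jn -> v 0 i = 0.
    move=> ij; have /eqP := vE i; rewrite c0 mulf_eq0 => /orP[/eqP //|].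
    rewrite subr_eq0 aj => /eqP; rewrite -val_eqE /= neq_ltn in ij.
    by case/orP: ij => /x_incr; lra.
  case/eqP: v0; apply/rowP => i; rewrite mxE.
  have [->|/vi //] := eqVneq i (Ordinal jn).
  have /eqP := c0; rewrite /c mulf_eq0 invr_eq0 (negbTE nR0) orbF.
  rewrite (bigD1 (Ordinal jn)) //= big1; last by move=> k /vi ->; rewrite mul0r.
  by rewrite addr0 mulf_eq0 (gt_eqF (x_gt0 _)) orbF => /eqP.
split=> //; rewrite secE //.
have c0 : c != 0.
  apply/eqP => c0; case/eqP: v0; apply/rowP => i; rewrite mxE.
  have /eqP := vE i; rewrite c0 mulf_eq0 subr_eq0 [x _ == _]eq_sym.
  rewrite (negbTE (ax _ _)) // orbF.
  by move/eqP.
have vE' j : v 0 j = - c / (a - x j).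
  have := ax j (ltn_ord j); rewrite -subr_eq0 => aj.
  by rewrite -(vE j); field.
apply: (mulfI c0); rewrite mulr0 mulrDr.
have -> : c * n%:R = \sum_(i < n) v 0 i * x i by rewrite divfK.
rewrite mulr_sumr -big_split big1 // => i _ /=; rewrite vE'.
by ring.
Qed.

(** Meaningful for [k.+1 < n], when the gap is bounded by two of the [n] poles. *)
Definition secular_zero (n k : nat) : R :=
  xget 0 [set t | gap x k t /\ secular x t n = 0].

Lemma secular_zeroP n k : (k.+1 < n)%N ->
  gap x k (secular_zero n k) /\ secular x (secular_zero n k) n = 0.
Proof.
move=> kn; rewrite /secular_zero; case: xgetP => [t -> [] //|h].
by have [t gt st] := secular_root x_incr kn; case: (h t).
Qed.

Definition trap_level (n j : nat) : R :=
  if j is k.+1 then secular_zero n k else 0.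

Lemma trap_level_lt n i j : (i < j)%N -> (j < n)%N -> trap_level n i < trap_level n j.
Proof.
case: j => // j ij jn /=; have [/andP[j1 j2] _] := secular_zeroP jn.
apply: le_lt_trans j1; case: i ij => [_|i ij] /=; first by rewrite ltW.
have [/andP[_ i2] _] := secular_zeroP (ltn_trans ij jn).
by rewrite (le_trans (ltW i2)) // incr_nondecr.
Qed.

Lemma trap_level_ge0 n j : (j < n)%N -> 0 <= trap_level n j.
Proof. by case: j => // j jn; exact: ltW (@trap_level_lt n 0 j.+1 isT jn). Qed.

Lemma trap_spectrumP n :
  increasing_spectrum (trap_matrix x n) (mkseq (trap_level n) n).
Proof.
split; first by rewrite size_mkseq.
- apply/(sortedP 0) => i; rewrite size_mkseq => iN.
  by rewrite !nth_mkseq ?trap_level_lt // ltnW.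
- by case: n.
move=> a; case: (posnP n) => [->|n0].
  by apply/esym/negbTE; apply/eigenvalueP => -[v _]; rewrite [v]thinmx0 eqxx.
apply/idP/idP => [/mapP[j]|/trap_eigenvalueP-/(_ n0)[ax /eqP]].
  rewrite mem_iota /= add0n => jn ->; apply/trap_eigenvalueP => //.
  case: j jn => [|k] kn /=; first by split=> [j _|]; [rewrite lt_eqF|rewrite mul0r].
  have [g s] := secular_zeroP kn; split; last by rewrite s mulr0.
  by move=> j _; rewrite -subr_eq0 (gap_neq _ _ g).
rewrite mulf_eq0 => /orP[/eqP->|/eqP s0].
  by apply/mapP; exists 0%N => //; rewrite mem_iota.
have [k kn g] := secular_root_gap x_incr n0 ax s0.
have [gz sz] := secular_zeroP kn.
apply/mapP; exists k.+1; first by rewrite mem_iota.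
by apply: (secular_inj x_incr n0 g gz); rewrite s0 sz.
Qed.

End trap_spectrum.

(** * Zeros of the secular function as the number of poles grows *)

Section secular_limit.
Context {R : realType}.
Variable x : nat -> R.
Hypothesis x_incr : {homo x : i j / (i < j)%N >-> i < j}.
Hypothesis x_gt0 : forall i, 0 < x i.
Hypothesis x_summable : cvgn (series (fun i => (x i)^-1)).

(* An upper bound for every finite sum of the (x i)^-1. *)
Let S := limn (series (fun i => (x i)^-1)).

Lemma sum_inv_le n (Q : pred nat) : \sum_(0 <= i < n | Q i) (x i)^-1 <= S.
Proof.
have h : \sum_(0 <= i < n | Q i) (x i)^-1 <= series (fun i => (x i)^-1) n.
  rewrite /series /= big_mkcond; apply: ler_sum => i _.
  by case: ifP => // _; rewrite invr_ge0 ltW.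
apply: le_trans h _; apply: nondecreasing_cvgn_le => //.
by apply/nondecreasing_series => i _ _; rewrite invr_ge0 ltW.
Qed.

Lemma sum_inv_gt0 : 0 < S.
Proof.
by have := sum_inv_le 1 predT; rewrite big_nat1; apply: lt_le_trans; rewrite invr_gt0.
Qed.

Lemma poles_unbounded B : exists k, B < x k.
Proof.
have /cvgr0Pnorm_lt /(_ (`|B| + 1)^-1) := cvg_series_cvg_0 x_summable.
rewrite invr_gt0 ltr_wpDl // => /(_ isT)[k _ /(_ k (leqnn k))].
rewrite ger0_norm ?invr_ge0 1?ltW // ltf_pV2 ?posrE // ?ltr_wpDl // => h.
by exists k; have := ler_norm B; lra.
Qed.

(** Away from the poles the terms [(s - x j)^-1] are dominated, uniformly in [s],
    by the summable sequence [(x j)^-1]. *)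
Lemma pole_dist_ge k a b : x k < a -> b < x k.+1 ->
  exists2 c, 0 < c & forall s j, a <= s <= b -> c * x j <= `|s - x j|.
Proof.
move=> ka bk; have xk := x_gt0 k; have xk1 := x_gt0 k.+1.
exists (Num.min ((a - x k) / x k) ((x k.+1 - b) / x k.+1)).
  by rewrite lt_min !divr_gt0 ?subr_gt0.
move=> s j /andP[as_ sb]; have [jk|kj] := leqP j k.
  have xj := incr_nondecr x_incr jk.
  apply: (@le_trans _ _ ((a - x k) / x k * x j)).
    by rewrite ler_wpM2r ?ge_min ?lexx // ltW.
  rewrite ger0_norm; last lra.
  apply: (@le_trans _ _ (a - x k)); last lra.
  by rewrite mulrAC ler_pdivrMr // ler_wpM2l // subr_ge0 ltW.
have xj := incr_nondecr x_incr kj.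
apply: (@le_trans _ _ ((x k.+1 - b) / x k.+1 * x j)).
  by rewrite ler_wpM2r ?ge_min ?lexx ?orbT // ltW.
rewrite ltr0_norm; last lra.
rewrite opprB mulrAC ler_pdivrMr //; have ? := x_gt0 j.
have b0 : 0 < b by lra.
by nra.
Qed.

Lemma secular_lipschitz k a b : x k < a -> b < x k.+1 ->
  exists L, forall s t n, a <= s <= b -> a <= t <= b ->
    `|secular x s n - secular x t n| <= L * `|t - s|.
Proof.
move=> ka bk; have [c c0 hc] := pole_dist_ge ka bk.
have dist0 s j : a <= s <= b -> s - x j != 0.
  by move=> /(hc _ j) h; rewrite -normr_gt0 (lt_le_trans _ h) // mulr_gt0.
exists (S / (c ^+ 2 * x 0%N)) => s t n sab tab.
rewrite (secular_sub (x := x)) ; [|by move=> j; exact: dist0..].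
rewrite normrM mulrC ler_wpM2r //.
apply: le_trans (ler_norm_sum _ _ _) _.
rewrite ler_pdivlMr ?mulr_gt0 ?exprn_gt0 //.
rewrite mulr_suml; apply: le_trans (sum_inv_le n predT).
apply: ler_sum => j _; have xj := x_gt0 j; have x0 := x_gt0 0%N.
have hs := hc s j sab; have ht := hc t j tab.
have x0j := incr_nondecr x_incr (leq0n j).
rewrite normfV normrM ler_pdivrMl ?mulr_gt0 ?normr_gt0 ?dist0 //.
rewrite ler_pdivlMr //.
apply: (@le_trans _ _ ((c * x j) * (c * x j))); last first.
  by rewrite ler_pM // ltW // mulr_gt0.
have -> : c * x j * (c * x j) = c ^+ 2 * x j * x j by ring.
by rewrite ler_wpM2r ?ler_wpM2l ?sqr_ge0 // ltW.
Qed.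

(** At a zero [t] the term [(t - x k)^-1] equals minus the sum of the others.  Only
    the poles beyond the gap contribute positively to that, and by a bounded
    amount, so [t] is not too close to [x k]. *)
Lemma secular_root_away k b : b < x k.+1 -> exists2 a, x k < a &
  forall t n, (k < n)%N -> x k < t <= b -> secular x t n = 0 -> a <= t.
Proof.
move=> bk.
have [xkb|bxk] := ltP (x k) b; last first.
  by exists (x k + 1); [rewrite ltrDl|move=> t n _ /andP[]; lra].
(* For j > k and t <= b, the distance x j - t is at least c * x j. *)
pose c := (x k.+1 - b) / x k.+1; have xk := x_gt0 k; have xk1 := x_gt0 k.+1.
have c0 : 0 < c by rewrite divr_gt0 // subr_gt0.
exists (x k + c / S); first by rewrite ltrDl divr_gt0 // sum_inv_gt0.
move=> t n kn /andP[kt tb] st0.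
suff h : (t - x k)^-1 <= S / c.
  rewrite addrC -lerBrDr -[c / S]invf_div -[t - _]invrK lef_pV2 //.
    by rewrite posrE divr_gt0 ?sum_inv_gt0.
  by rewrite posrE invr_gt0 subr_gt0.
have -> : (t - x k)^-1 = \sum_(0 <= j < n | j != k) - (t - x j)^-1.
  move: st0; rewrite /secular /series /= (bigD1_seq k) ?mem_index_iota ?iota_uniq //=.
  by rewrite sumrN => /eqP; rewrite addr_eq0 => /eqP.
rewrite ler_pdivlMr // mulr_suml.
apply: le_trans (sum_inv_le n (fun j => j != k)).
apply: ler_sum => j jk; have xj := x_gt0 j.
have [jk'|kj] := ltnP j k.
  have : x j < x k by exact: x_incr.
  move=> xjk; apply: (@le_trans _ _ 0); last by rewrite invr_ge0 ltW.
  by rewrite mulNr oppr_le0 mulr_ge0 ?invr_ge0 ?subr_ge0 // ltW //; lra.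
have {jk}kj : (k < j)%N by rewrite ltn_neqAle eq_sym jk.
have xkj := incr_nondecr x_incr kj.
rewrite -invrN opprB mulrC ler_pdivrMr; last lra.
rewrite ler_pdivlMl // /c mulrA ler_pdivrMr //.
by nra.
Qed.

(** The pole added when passing from [m] to [m.+1] terms lies to the right of the
    gap, so the secular function gets smaller there, and so does its zero. *)
Lemma secular_zero_decr k n m : (k.+1 < n)%N -> (n <= m)%N ->
  secular_zero x m k <= secular_zero x n k.
Proof.
move=> kn; elim: m => [|m ih]; first by rewrite leqn0 => /eqP <-.
rewrite leq_eqVlt => /orP[/eqP-> //|]; rewrite ltnS => nm.
apply: le_trans (ih nm); have km := leq_trans kn nm.
have [g s] := secular_zeroP x_incr km.
have [g' s'] := secular_zeroP x_incr (ltnW km : (k.+1 < m.+1)%N).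
rewrite leNgt; apply/negP => lt.
have := secular_decr x_incr (ltn0Sn m) g g' (ltW lt).
rewrite s' add0r secularS s add0r.
apply/negP; rewrite -ltNge; apply: (@lt_trans _ _ 0).
  rewrite invr_lt0 subr_lt0; case/andP: g => _ g2; apply: lt_le_trans g2 _.
  by rewrite incr_nondecr // ltnW.
by rewrite divr_gt0 ?subr_gt0 // (gap_same_side x_incr 0 g g').
Qed.

(** The zeros decrease and stay in a compact part of the gap.  With the uniform
    Lipschitz constant, the value at the limit point [t] of the secular function
    with [n] terms is at most [L * `|secular_zero x n k - t|]. *)
Lemma secular_zero_cvg k : exists t,
  [/\ gap x k t, secular_zero x ^~ k @ \oo --> t & secular x t @ \oo --> (0 : R)].
Proof.
(* The zero is defined from n = k.+2 on. *)
pose N := k.+2; pose u i := secular_zero x (i + N) k.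
have uP i : gap x k (u i) /\ secular x (u i) (i + N) = 0.
  by apply: secular_zeroP => //; rewrite /N; lia.
have u_decr : {homo u : i j / (i <= j)%N >-> j <= i}.
  by move=> i j ij; apply: secular_zero_decr; rewrite /N; lia.
have [/andP[ku0 u0k] _] := uP 0%N.
have [a ka ha] := secular_root_away u0k.
have ua i : a <= u i <= u 0%N.
  have [/andP[kui uik] si] := uP i; rewrite u_decr // andbT.
  apply: (ha _ (i + N)%N) => //; first by rewrite /N; lia.
  by rewrite kui u_decr.
have ucvg : cvgn u.
  apply: nonincreasing_is_cvgn => //; exists a => _ [i _ <-].
  by case/andP: (ua i).
have ua_lim : a <= limn u <= u 0%N.
  apply/andP; split; last exact: nonincreasing_cvgn_ge.
  by apply: limr_ge => //; apply: nearW => i; case/andP: (ua i).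
have zcvg : secular_zero x ^~ k @ \oo --> limn u.
  by rewrite -(cvg_shiftn N).
exists (limn u); split=> //.
  by case/andP: ua_lim => ? ?; apply/andP; split;
    [exact: lt_le_trans ka _|exact: le_lt_trans u0k].
have [L hL] := secular_lipschitz ka u0k.
rewrite -(cvg_shiftn N).
apply: norm_cvg0.
apply: (@squeeze_cvgr _ _ _ _ (fun=> 0) (fun i => L * `|u i - limn u|)).
- apply: nearW => i; rewrite normr_ge0 /=.
  have [_ si] := uP i; have := hL (limn u) (u i) (i + N)%N ua_lim (ua i).
  by rewrite si subr0.
- exact: cvg_cst.
- rewrite -(mulr0 L); apply: cvgMr; rewrite -(normr0 R); apply: cvg_norm.
  by rewrite -(subrr (limn u)); apply: cvgB => //; exact: cvg_cst.
Qed.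

Lemma secular_limit_zero_uniq k s t : gap x k s -> gap x k t ->
  secular x s @ \oo --> (0 : R) -> secular x t @ \oo --> (0 : R) -> s = t.
Proof.
wlog st : s t / s <= t => [th gs gt|gs gt hs ht].
  by case: (leP s t) => [|/ltW] /th h hs ht; [exact: h|apply/esym/h].
apply/eqP; rewrite eq_le st /= -subr_le0.
set e := (s - x 0%N) * (t - x 0%N).
have e0 : 0 < e by exact: (gap_same_side x_incr 0 gs gt).
suff : (t - s) / e <= 0 by rewrite pmulr_lle0 // invr_gt0.
have hd : secular x s n - secular x t n @[n --> \oo] --> (0 - 0 : R) by exact: cvgB.
rewrite subr0 in hd; rewrite -(cvg_lim _ hd) //.
apply: limr_ge; first by apply/cvg_ex; exists 0.
exists 1%N => // n /= n0; rewrite lerBrDl.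
rewrite /e; apply (secular_decr x_incr n0 gs gt st).
Qed.

Lemma secular_limit_zero_gap t : (forall j, t != x j) ->
  secular x t @ \oo --> (0 : R) -> exists k, gap x k t.
Proof.
move=> tx ht; have [t0|t0] := ltP t (x 0%N).
  have : 0 <= (t - x 0%N)^-1.
    rewrite -(cvg_lim _ ht) //; apply: limr_le; first by apply/cvg_ex; exists 0.
    by exists 1%N => // n /= n0; exact: secular_left_of_poles.
  by rewrite invr_ge0; lra.
have [N tN] := poles_unbounded t.
have [|lt0|/= Nt|[k _ gk]] := @pole_locate _ x N.+1 t isT; first by [].
- by lra.
- by lra.
- by exists k.
Qed.

End secular_limit.

(** * Real and complex solutions of the limit equation *)

Section complex_sequences.
Context {R : realType}.

Lemma Im_sum (I : Type) (r : seq I) (F : I -> R[i]%C) :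
  complex.Im (\sum_(i <- r) F i) = \sum_(i <- r) complex.Im (F i).
Proof. by apply: (big_morph (@complex.Im R)) => // -[? ?] [? ?]. Qed.

Lemma ImV (z : R[i]%C) :
  complex.Im z^-1 = - complex.Im z / (complex.Re z ^+ 2 + complex.Im z ^+ 2).
Proof. by case: z => a b; rewrite /= mulNr. Qed.

Lemma normc_ge_Im (z : R[i]%C) : `|complex.Im z|%:C%C <= `|z|.
Proof.
by rewrite normc_def lecR -sqrtr_sqr ler_wsqrtr // lerDr sqr_ge0.
Qed.

Lemma normc_real (a : R) : `|a%:C%C| = `|a|%:C%C.
Proof. by rewrite normc_def /= expr0n addr0 sqrtr_sqr. Qed.

(** In this form the convergence over the complex numbers is compared with that of
    real sequences, through the norms of real complex numbers and imaginary parts. *)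
Lemma limit_spectrum_norm (K : numFieldType) (y : nat -> K) (z : K) :
  limit_spectrum y z <-> (forall k, z != y k) /\
    forall e, 0 < e -> \forall n \near \oo, `|series (fun k => z / (z - y k)) n| < e.
Proof. by split=> -[zy h]; split=> //; apply/cvgr0Pnorm_lt. Qed.

Lemma series_secular_real (x : nat -> R) (t : R) n :
  series (fun k => t%:C%C / (t%:C%C - (x k)%:C%C)) n = (t * secular x t n)%:C%C.
Proof.
rewrite /series /= rmorphM rmorph_sum /= mulr_sumr; apply: eq_bigr => k _.
by rewrite fmorphV rmorphB.
Qed.

Lemma complex_limit_spectrum_real (x : nat -> R) (t : R) :
  complex_limit_spectrum x t%:C%C <->
  (forall k, t != x k) /\ (t = 0 \/ secular x t @ \oo --> (0 : R)).
Proof.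
have neqE k : (t%:C%C != (x k)%:C%C) = (t != x k) by rewrite eq_complex /= eqxx andbT.
rewrite /complex_limit_spectrum limit_spectrum_norm.
under eq_forall do rewrite neqE.
split=> -[tx h]; split=> //.
  have [->|t0] := eqVneq t 0; [by left|right].
  apply/cvgr0Pnorm_lt => e e0.
  have /h : 0 < (`|t| * e)%:C%C by rewrite ltcR mulr_gt0 // normr_gt0.
  apply: filterS => n; rewrite series_secular_real normc_real ltcR normrM.
  by rewrite ltr_pM2l // normr_gt0.
move=> e e0; case: h => [->|h].
  by apply: nearW => n; rewrite series_secular_real mul0r normr0.
have eE : e = (complex.Re e)%:C%C.
  by case: e e0 => a b; rewrite ltcE /= => /andP[/eqP -> _].
have e0' : 0 < complex.Re e by rewrite -ltcR -eE.
have /cvgr0Pnorm_lt /(_ _ e0') : (fun n => t * secular x t n) @ \oo --> (0 : R).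
  by rewrite -(mulr0 t); exact: cvgMr.
by apply: filterS => n; rewrite series_secular_real normc_real [in X in _ -> X]eE ltcR.
Qed.

(** All the [(z - x k)^-1] have an imaginary part of the sign opposite to that of
    [z], so the partial sums are bounded away from [0] by the first term. *)
Lemma complex_limit_spectrum_is_real (x : nat -> R) (z : R[i]%C) :
  complex_limit_spectrum x z -> z = (complex.Re z)%:C%C.
Proof.
rewrite /complex_limit_spectrum limit_spectrum_norm => -[zx h].
have [z0|z0] := eqVneq (complex.Im z) 0; first by case: z z0 {zx h} => a b /= ->.
have zn0 : z != 0 by apply: contraNneq z0 => ->.
pose d k : R := complex.Re (z - (x k)%:C%C) ^+ 2 + complex.Im (z - (x k)%:C%C) ^+ 2.
have ImE k : complex.Im (z - (x k)%:C%C) = complex.Im z.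
  by case: z {zx h z0 zn0 d} => a b /=; rewrite subr0.
have d0 k : 0 < d k by rewrite /d ltr_wpDl ?sqr_ge0 // ImE exprn_even_gt0.
have /h : 0 < `|z| * (`|complex.Im z| / d 0%N)%:C%C.
  by rewrite mulr_gt0 ?normr_gt0 // ltcR divr_gt0 ?normr_gt0.
case=> N _ /(_ N.+1 (leqnSn N)) /=; rewrite /series /= -mulr_sumr normrM.
rewrite ltr_pM2l ?normr_gt0 // => /lt_geF /negbT /negP; case.
apply: le_trans (normc_ge_Im _); rewrite lecR Im_sum.
rewrite (eq_bigr (fun k => - complex.Im z * (d k)^-1)); last first.
  by move=> k _; rewrite ImV -/(d k) ImE.
rewrite -mulr_sumr normrM normrN ler_wpM2l //.
rewrite ger0_norm; last by apply: sumr_ge0 => k _; rewrite invr_ge0 ltW.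
rewrite big_nat_recl //= lerDl.
by apply: sumr_ge0 => k _; rewrite invr_ge0 ltW.
Qed.

End complex_sequences.

(** * The limit levels *)

Section limit_levels.
Context {R : realType}.
Variable x : nat -> R.
Hypothesis x_incr : {homo x : i j / (i < j)%N >-> i < j}.
Hypothesis x_gt0 : forall i, 0 < x i.
Hypothesis x_summable : cvgn (series (fun i => (x i)^-1)).

Definition limit_level (j : nat) : R := limn (fun n => trap_level x n j).

Lemma limit_level0 : limit_level 0 = 0.
Proof. exact: lim_cst. Qed.

Lemma limit_levelSP k : gap x k (limit_level k.+1) /\
  secular x (limit_level k.+1) @ \oo --> (0 : R).
Proof.
have [t [gt zt st]] := secular_zero_cvg x_incr x_gt0 x_summable k.
by rewrite /limit_level /= (cvg_lim _ zt).
Qed.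

Lemma trap_level_cvg j : (fun n => trap_level x n j) @ \oo --> limit_level j.
Proof.
case: j => [|k]; first by rewrite limit_level0; exact: cvg_cst.
have [t [gt zt st]] := secular_zero_cvg x_incr x_gt0 x_summable k.
by rewrite /limit_level /= (cvg_lim _ zt).
Qed.

Lemma limit_level_lt : {homo limit_level : i j / (i < j)%N >-> i < j}.
Proof.
move=> i [//|j]; rewrite ltnS => ij; have [/andP[j1 _] _] := limit_levelSP j.
apply: le_lt_trans j1; case: i ij => [|i] ij; first by rewrite limit_level0 ltW.
have [/andP[_ i2] _] := limit_levelSP i.
by rewrite (le_trans (ltW i2)) // incr_nondecr.
Qed.

Lemma limit_level_ge0 j : 0 <= limit_level j.
Proof.
by case: j => [|j]; rewrite -?limit_level0 // ltW // limit_level_lt.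
Qed.

Lemma complex_limit_spectrumE :
  complex_limit_spectrum x = range (fun j => (limit_level j)%:C%C).
Proof.
apply/seteqP; split=> [z zs|_ [j _ <-]].
  have zr := complex_limit_spectrum_is_real zs.
  move: zs; rewrite zr => /complex_limit_spectrum_real [zx [z0|h]].
    by exists 0%N => //; rewrite limit_level0 z0.
  have [k gk] := secular_limit_zero_gap x_incr x_gt0 x_summable zx h.
  have [gl hl] := limit_levelSP k.
  exists k.+1 => //.
  by rewrite (secular_limit_zero_uniq x_incr gk gl).
apply/complex_limit_spectrum_real; case: j => [|k].
  by rewrite limit_level0; split; [move=> k; rewrite lt_eqF|left].
have [gl hl] := limit_levelSP k; split; last by right.
by move=> j; rewrite -subr_eq0 (gap_neq _ _ gl).
Qed.

End limit_levels.

(** * Integrals against point measures *)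

Section point_measure_integral.
Context {R : realType}.

Lemma nneseries_trunc (u : nat -> \bar R) K :
  (forall i, (0 <= u i)%E) -> (forall i, (K <= i)%N -> u i = 0%E) ->
  (\sum_(0 <= i <oo) u i = \sum_(0 <= i < K) u i)%E.
Proof.
move=> u0 uK; rewrite (nneseries_split 0 K) //= add0n eseries0 ?adde0 //.
by move=> i Ki _; exact: uK.
Qed.

Local Notation halfline := (`[0%R, +oo[%classic : set R).

Lemma integral_dirac_halfline (y : R) (f : R -> R) :
  measurable_fun halfline f -> 0 <= y ->
  (\int[\d_y]_(t in halfline) (f t)%:E = (f y)%:E)%E.
Proof.
move=> mf y0; rewrite integral_dirac //; last exact/measurable_EFinP.
have Dy : halfline y by rewrite /= in_itv /= y0.
by rewrite diracE mem_set // mul1e.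
Qed.

Lemma ge0_integral_point_measure (y : nat -> R) (f : R -> R) K :
  measurable_fun halfline f -> (forall t, 0 <= f t) -> (forall i, 0 <= y i) ->
  (forall i, (K <= i)%N -> f (y i) = 0) ->
  (\int[point_measure y]_(t in halfline) (f t)%:E
    = (\sum_(0 <= i < K) f (y i))%:E)%E.
Proof.
move=> mf f0 y0 fK; rewrite ge0_integral_measure_series //; last 2 first.
- by move=> t _; rewrite lee_fin.
- exact/measurable_EFinP.
rewrite (eq_eseriesr (g := fun i => (f (y i))%:E)); last first.
  by move=> i _; rewrite integral_dirac_halfline.
rewrite (@nneseries_trunc _ K) ?sumEFin // => i; first by rewrite lee_fin.
by move=> /fK ->.
Qed.

Lemma ge0_integral_finite_point_measure (s : seq R) (f : R -> R) :
  measurable_fun halfline f -> (forall t, 0 <= f t) ->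
  (forall i, (i < size s)%N -> 0 <= nth 0 s i) ->
  (\int[finite_point_measure s]_(t in halfline) (f t)%:E
    = (\sum_(0 <= i < size s) f (nth 0 s i))%:E)%E.
Proof.
move=> mf f0 y0; rewrite ge0_integral_measure_sum //; last 2 first.
- by move=> t _; rewrite lee_fin.
- exact/measurable_EFinP.
rewrite big_mkord -sumEFin; apply: eq_bigr => i _.
by rewrite integral_dirac_halfline // y0.
Qed.

Definition pos_part (f : R -> R) (t : R) : R := Num.max (f t) 0.

Lemma pos_part_ge0 f t : 0 <= pos_part f t.
Proof. by rewrite /pos_part le_max lexx orbT. Qed.

Lemma measurable_pos_part f :
  measurable_fun halfline f -> measurable_fun halfline (pos_part f).
Proof. by move=> mf; apply: measurable_maxr => //; exact: measurable_cst. Qed.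

Lemma pos_part_eq0 f t : f t = 0 -> pos_part f t = 0.
Proof. by rewrite /pos_part => ->; rewrite maxxx. Qed.

Lemma pos_partB f t : pos_part f t - pos_part (fun t => - f t) t = f t.
Proof.
rewrite /pos_part; have [f0|/ltW f0] := leP (f t) 0.
  by rewrite max_l ?oppr_ge0 // sub0r opprK.
by rewrite max_r ?oppr_le0 // subr0.
Qed.

Lemma integral_pos_partB (mu : {measure set R -> \bar R}) f :
  (\int[mu]_(t in halfline) (f t)%:E =
   \int[mu]_(t in halfline) (pos_part f t)%:E
   - \int[mu]_(t in halfline) (pos_part (fun t => - f t) t)%:E)%E.
Proof.
rewrite integralE; congr (_ - _)%E; apply: eq_integral => t _.
  by rewrite funeposE /pos_part EFin_max.
by rewrite funenegE /pos_part EFin_max EFinN.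
Qed.

Lemma integral_point_measure (y : nat -> R) (f : R -> R) K :
  measurable_fun halfline f -> (forall i, 0 <= y i) ->
  (forall i, (K <= i)%N -> f (y i) = 0) ->
  (\int[point_measure y]_(t in halfline) (f t)%:E
    = (\sum_(0 <= i < K) f (y i))%:E)%E.
Proof.
move=> mf y0 fK; have mNf : measurable_fun halfline (fun t => - f t)
  by exact: measurableT_comp.
rewrite integral_pos_partB !(@ge0_integral_point_measure y _ K) //;
  try exact: measurable_pos_part; try exact: pos_part_ge0; try by move=> i /fK fi; rewrite pos_part_eq0 // fi oppr0.
by rewrite -EFinB -sumrB; congr EFin; apply: eq_bigr => i _; exact: pos_partB.
Qed.

Lemma integral_finite_point_measure (s : seq R) (f : R -> R) K :
  measurable_fun halfline f ->
  (forall i, (i < size s)%N -> 0 <= nth 0 s i) -> (K <= size s)%N ->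
  (forall i, (K <= i < size s)%N -> f (nth 0 s i) = 0) ->
  (\int[finite_point_measure s]_(t in halfline) (f t)%:E
    = (\sum_(0 <= i < K) f (nth 0 s i))%:E)%E.
Proof.
move=> mf y0 Ks fK; have mNf : measurable_fun halfline (fun t => - f t)
  by exact: measurableT_comp.
rewrite integral_pos_partB !ge0_integral_finite_point_measure //;
  try exact: measurable_pos_part; try exact: pos_part_ge0.
rewrite -EFinB -sumrB; congr EFin.
rewrite (eq_bigr (fun i => f (nth 0 s i))); last by move=> i _; exact: pos_partB.
rewrite (big_cat_nat (leq0n K) Ks) //= -[RHS]addr0; congr (_ + _).
by rewrite big_nat_cond big1 // => i /[!andbT]; exact: fK.
Qed.

Lemma finite_point_measure_locally_bounded (s : seq R) :
  locally_bounded_halfline (finite_point_measure s).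
Proof.
move=> K _ _; rewrite /finite_point_measure /= /msum.
apply/lte_sum_pinfty => i _.
by rewrite /= diracE ltry.
Qed.

Lemma point_measure_locally_bounded (y : nat -> R) :
  (forall B, exists K, forall i, (K <= i)%N -> B < y i) ->
  locally_bounded_halfline (point_measure y).
Proof.
move=> yoo K /compact_bounded [M [_ KM]] _.
have [n hn] := yoo (M + 1).
rewrite /point_measure /= /mseries (@nneseries_trunc _ n) //; last first.
  move=> i ni; rewrite /= diracE memNset //= => /(KM (M + 1)).
  rewrite ltrDl ltr01 => /(_ isT) /=.
  by rewrite leNgt => /negP; apply; rewrite (lt_le_trans (hn _ ni)) // ler_norm.
by apply/lte_sum_pinfty => i _; rewrite /= diracE ltry.
Qed.

Lemma test_function_support (f : R -> R) : test_function_halfline f ->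
  exists B : R, forall t : R, 0 <= t -> B < t -> f t = 0.
Proof.
move=> [_ /compact_bounded [M [_ fM]]]; exists (M + 1) => t t0 Mt.
apply/eqP/negP => /negP ft.
have : closure (`[0, +oo[ `&` [set t | f t != 0]) t.
  by apply: subset_closure; split=> //=; rewrite in_itv /= t0.
move=> /(fM (M + 1)); rewrite ltrDl ltr01 => /(_ isT) /=.
by rewrite leNgt => /negP; apply; rewrite (lt_le_trans Mt) // ler_norm.
Qed.

Lemma test_function_measurable (f : R -> R) : test_function_halfline f ->
  measurable_fun halfline f.
Proof. by move=> [cf _]; apply: subspace_continuous_measurable_fun. Qed.

(** The test function is continuous on the half-line only, so a sequence that
    converges to the boundary point [0] has to stay on the half-line. *)
Lemma test_function_cvg (f : R -> R) (u : nat -> R) (l : R) :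
  test_function_halfline f ->
  0 <= l -> (\forall n \near \oo, 0 <= u n) -> u @ \oo --> l ->
  (fun n => f (u n)) @ \oo --> f l.
Proof.
move=> [/subspace_continuousP cf _] l0 u0 ul.
have Dl : halfline l by rewrite /= in_itv /= l0.
apply: cvg_comp (cf l Dl) => P /= wP.
have := ul _ wP; rewrite /nbhs /=; apply: filterS2 u0 => n un; apply.
by rewrite /= in_itv /= un.
Qed.

End point_measure_integral.

(** * Vague convergence of the spectra *)

Section counting.
Context {R : realType}.
Variable E : nat -> R.
Hypothesis E_decr : forall i, E i.+1 < E i.
Hypothesis E_unbounded : forall B, exists k, E k < B.

Lemma decr_nonincr i j : (i <= j)%N -> E j <= E i.
Proof.
elim: j => [|j ih]; first by rewrite leqn0 => /eqP ->.
rewrite leq_eqVlt => /orP[/eqP -> //|/ih]; apply: le_trans; exact: ltW.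
Qed.

Lemma count_above_ge e k : e <= E k -> (k < count_above E e)%N.
Proof.
move=> ek; have [m mE] := E_unbounded e.
pose Q n := (0 < n)%N && (e <= E n.-1).
have Qk : exists n, Q n by exists k.+1; rewrite /Q /= ek.
have Qm n : Q n -> (n <= m)%N.
  move=> /andP[n0 en]; rewrite leqNgt; apply/negP => mn.
  have /decr_nonincr : (m <= n.-1)%N by rewrite -ltnS prednK.
  by lra.
rewrite /count_above; case: xgetP => [n _ [_ _ h]|h]; first exact: (h k.+1).
case: (ex_maxnP Qk Qm) => n /andP[n0 en] nmax; case: (h n).
by split=> // j j0 ej; apply: nmax; rewrite /Q j0.
Qed.

Lemma count_above_cvg : count_above E e @[e --> ninfty_nbhs R] --> \oo.
Proof.
move=> P [k _ kP]; exists (E k); split; first exact: num_real.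
move=> e /ltW /count_above_ge ke; apply: kP => /=; exact: ltnW.
Qed.

End counting.

Section vague_convergence_of_spectra.
Context {R : realType}.
Variable x : nat -> R.
Hypothesis x_incr : {homo x : i j / (i < j)%N >-> i < j}.
Hypothesis x_gt0 : forall i, 0 < x i.
Hypothesis x_summable : cvgn (series (fun i => (x i)^-1)).

Lemma nth_trap_spectrum n i : (i < n)%N ->
  nth 0 (mkseq (trap_level x n) n) i = trap_level x n i.
Proof. exact: nth_mkseq. Qed.

Lemma limit_level_unbounded B :
  exists K, forall i, (K <= i)%N -> B < limit_level x i.
Proof.
have [k Bk] := poles_unbounded x_gt0 x_summable B.
exists k.+1 => -[//|i]; rewrite ltnS => ki.
have [/andP[i1 _] _] := limit_levelSP x_incr x_gt0 x_summable i.
by apply: lt_trans Bk (le_lt_trans _ i1); exact: incr_nondecr.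
Qed.

Lemma trap_level_unbounded B :
  exists K, forall n i, (K <= i < n)%N -> B < trap_level x n i.
Proof.
have [k Bk] := poles_unbounded x_gt0 x_summable B; exists k.+1 => n [//|i].
rewrite ltnS => /andP[ki /(secular_zeroP x_incr)[/andP[i1 _] _]] /=.
by apply: lt_trans Bk (le_lt_trans _ i1); exact: incr_nondecr.
Qed.

(** Beyond a label [K] that depends only on the support of [f], all levels lie
    outside the support, for every [n] and in the limit. *)
Lemma integral_trap_spectrum_cvg (f : R -> R) : test_function_halfline f ->
  (\int[finite_point_measure (mkseq (trap_level x n) n)]_(t in `[0%R, +oo[) (f t)%:E)%E
    @[n --> \oo] -->
  (\int[point_measure (limit_level x)]_(t in `[0%R, +oo[) (f t)%:E)%E.
Proof.
move=> tf; have mf := test_function_measurable tf.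
have [B fB] := test_function_support tf.
have [K1 hK1] := limit_level_unbounded B; have [K2 hK2] := trap_level_unbounded B.
pose K := maxn K1 K2.
have ll0 := limit_level_ge0 x_incr x_gt0 x_summable.
rewrite (@integral_point_measure _ _ _ K) //; last first.
  by move=> i Ki; rewrite fB // hK1 // (leq_trans _ Ki) // leq_maxl.
have tl0 n i : (i < n)%N -> 0 <= nth 0 (mkseq (trap_level x n) n) i.
  by move=> ni; rewrite nth_trap_spectrum // trap_level_ge0.
suff h : (\sum_(0 <= i < K) f (trap_level x n i))%:E @[n --> \oo] -->
    (\sum_(0 <= i < K) f (limit_level x i))%:E.
  apply: cvg_trans h; apply: near_eq_cvg; exists K => // n /= Kn.
  rewrite (@integral_finite_point_measure _ _ _ K) ?size_mkseq //.
  - congr EFin; apply: eq_big_nat => i /andP[_ iK].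
    by rewrite nth_trap_spectrum // (leq_trans iK).
  - by move=> i; exact: tl0.
  - move=> i /andP[Ki ni]; rewrite fB //; first exact: tl0.
    rewrite nth_trap_spectrum // hK2 // ni andbT (leq_trans _ Ki) //.
    exact: leq_maxr.
apply: cvg_EFin; first by apply: nearW.
rewrite /comp /=; elim: K {hK1 hK2} => [|k ih].
  by under eq_fun do rewrite big_nil; rewrite big_nil; exact: cvg_cst.
under eq_fun do rewrite big_nat_recr //=.
rewrite big_nat_recr //=; apply: cvgD ih _.
have tk : trap_level x n k @[n --> \oo] --> limit_level x k by exact: trap_level_cvg.
apply: (@test_function_cvg _ f (fun n => trap_level x n k) _ tf (ll0 k) _ tk).
by exists k.+1 => // n /= kn; exact: trap_level_ge0.
Qed.

Lemma vague_cvg_trap_spectrum (N : R -> nat) : N e @[e --> ninfty_nbhs R] --> \oo ->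
  vague_cvg_halfline (ninfty_nbhs R)
    (fun e => finite_point_measure (mkseq (trap_level x (N e)) (N e)))
    (point_measure (limit_level x)).
Proof.
move=> Noo; split.
- by move=> e; exact: finite_point_measure_locally_bounded.
- exact/point_measure_locally_bounded/limit_level_unbounded.
- by move=> f /integral_trap_spectrum_cvg; exact: cvg_comp.
Qed.

End vague_convergence_of_spectra.

(** * Mean of a Poisson variable, mass of an interval *)

Section nonnegative_series.
Context {R : realType}.

Lemma nneseries_EFin (u : nat -> R) (l : R) : series u @ \oo --> l ->
  (\sum_(0 <= i <oo) (u i)%:E = l%:E)%E.
Proof.
move=> ul; apply/cvg_lim => //.
under eq_fun do rewrite sumEFin.
by apply: cvg_EFin; [apply: nearW|exact: ul].
Qed.

Lemma nneseries_cvgn (u : nat -> R) : (forall i, 0 <= u i) ->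
  (\sum_(0 <= i <oo) (u i)%:E < +oo)%E -> cvgn (series u).
Proof.
move=> u0 uoo; have u0' i : (0 <= (u i)%:E)%E by rewrite lee_fin.
apply: nondecreasing_is_cvgn; first by apply: nondecreasing_series => i _ _; exact: u0.
exists (fine (\sum_(0 <= i <oo) (u i)%:E)) => _ [n _ <-].
rewrite -lee_fin fineK ?ge0_fin_numE ?nneseries_ge0 //.
by rewrite /series /= -sumEFin nneseries_lim_ge.
Qed.

Lemma nneseries_ge_term (u : nat -> \bar R) k : (forall i, (0 <= u i)%E) ->
  (u k <= \sum_(0 <= i <oo) u i)%E.
Proof.
move=> u0; apply: le_trans (nneseries_lim_ge k.+1 _) => //.
by rewrite big_nat_recr //= leeDr // sume_ge0.
Qed.

End nonnegative_series.

Section poisson_mean.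
Context {R : realType} {d : measure_display} {T : measurableType d}.
Variable P : probability T R.

(** The events [N = k] have total mass one, so [N] is almost surely an integer; then
    [k * P (N = k) = r * P (N = k - 1)] for [k >= 1]. *)
Lemma poisson_mean (N : T -> \bar R) (r : R) :
  measurable_fun setT N -> (forall w, (0 <= N w)%E) ->
  poisson_distributed P N r%:E -> (\int[P]_w N w = r%:E)%E.
Proof.
move=> mN N0 PN; pose A k := [set w | N w = k%:R%:E].
have mA k : measurable (A k).
  by have := mN measurableT _ (emeasurable_set1 k%:R%:E); rewrite setTI.
have tA : trivIset setT A.
  by apply/trivIsetP => i j _ _ ij; apply/seteqP; split=> // w [iw jw];
    have := etrans (esym iw) jw => -[] /eqP; rewrite eqr_nat (negbTE ij).
have PA k : P (A k) = (exp_coeff r k * expR (- r))%:E by rewrite /A PN.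
have sumPA : (\sum_(0 <= k <oo) P (A k) = 1)%E.
  rewrite (eq_eseriesr (g := fun k => (exp_coeff r k * expR (- r))%:E)) //.
  apply: nneseries_EFin.
  have -> : series (fun k => exp_coeff r k * expR (- r))
      = (fun n => series (exp_coeff r) n * expR (- r)).
    by apply/funext => n; rewrite /series /= mulr_suml.
  have -> : 1 = expR r * expR (- r) by rewrite -expRD subrr expR0.
  by apply: cvgMl; exact: is_cvg_series_exp_coeff.
have mU : measurable (\bigcup_k A k) by exact: bigcup_measurable.
have PU : P (~` (\bigcup_k A k)) = 0%E.
  rewrite probability_setC // measure_bigcup //.
  rewrite (eq_eseriesl (Q := xpredT)) ?sumPA ?subee // => k.
  by rewrite in_setT.
rewrite (@ge0_negligible_integral _ _ _ _ _ (~` (\bigcup_k A k))) //; last first.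
  exact: measurableC.
rewrite setTD setCK ge0_integral_bigcup //; last exact: measurable_funS mN.
rewrite (eq_eseriesr (g := fun k => (k%:R%:E * P (A k))%E)); last first.
  move=> k _; rewrite (eq_integral (cst k%:R%:E)) ?integral_cst // => w.
  by rewrite inE => ->.
have g0 k : (0 <= k%:R%:E * P (A k))%E by rewrite mule_ge0 // lee_fin.
rewrite nneseries_recl // mul0e add0e.
rewrite -(nneseries_addn 1) //.
rewrite (eq_eseriesr (g := fun k => (r%:E * P (A k))%E)); last first.
  move=> k _; rewrite !PA -!EFinM; congr EFin.
  rewrite /exp_coeff /= addn1 exprS factS natrM.
  by field; rewrite nat1r !pnatr_eq0 -lt0n fact_gt0.
by rewrite nneseriesZl // sumPA mule1.
Qed.

End poisson_mean.

Section exponential_intensity.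
Context {R : realType}.

Lemma exp_intensity_itv (alpha a b : R) : 0 < alpha -> a < b ->
  exists2 r : R, exp_intensity alpha `]a, b] = r%:E &
    r <= alpha * expR (- alpha * a) * (b - a).
Proof.
move=> al0 ab.
have m1 : measurable_fun (`]a, b] : set R) (fun t => (alpha * expR (- alpha * t))%:E).
  apply/measurable_EFinP; apply: measurable_funM; first exact: measurable_cst.
  apply: measurableT_comp; first exact: measurable_expR.
  by apply: measurable_funM; [exact: measurable_cst|exact: measurable_id].
have i0 : (0 <= exp_intensity alpha `]a, b])%E.
  by apply: integral_ge0 => t _; rewrite lee_fin mulr_ge0 ?expR_ge0 // ltW.
have ile : (exp_intensity alpha `]a, b] <= (alpha * expR (- alpha * a) * (b - a))%:E)%E.
  apply: (@le_trans _ _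
    (\int[lebesgue_measure]_(t in `]a, b]) (cst (alpha * expR (- alpha * a))%:E t))%E).
    apply: ge0_le_integral => //.
    - by move=> t _; rewrite lee_fin mulr_ge0 ?expR_ge0 // ltW.
    - move=> t /=; rewrite in_itv /= => /andP[at_ _].
      by rewrite lee_fin ler_pM2l // ler_expR !mulNr lerN2 ler_pM2l // ltW.
  rewrite integral_cst //= lebesgue_measure_itv /= lte_fin ab.
  by rewrite -EFinB -EFinM.
exists (fine (exp_intensity alpha `]a, b])); last first.
  by rewrite -lee_fin fineK // ge0_fin_numE // (le_lt_trans ile) // ltry.
by rewrite fineK // ge0_fin_numE // (le_lt_trans ile) // ltry.
Qed.

End exponential_intensity.

(** * Almost sure summability *)

Section summability.
Context {R : realType} {d : measure_display} {T : measurableType d}.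
Variable P : probability T R.
Variables (alpha : R) (E : nat -> {RV P >-> R}).
Hypothesis alpha01 : 0 < alpha < 1.
Hypothesis poissonE : poisson_point_process E (exp_intensity alpha).

Let count (B : set R) (w : T) : \bar R := point_measure (fun i => E i w) B.

Lemma count_ge0 B w : (0 <= count B w)%E.
Proof. exact: measure_ge0. Qed.

Lemma measurable_count B : measurable B -> measurable_fun setT (count B).
Proof.
move=> mB; apply: ge0_emeasurable_sum => [i w _ _ //|i _].
apply: (@measurableT_comp _ _ _ _ _ _ (fun t : R => \d_t B : \bar R)) => //.
exact: measurable_fun_dirac.
Qed.

(** The layers [m = 0, 1, ...] cut the half-line [t <= M] into intervals of
    length one, on which [expR] is comparable with its value at the right end. *)
Definition layer (M m : nat) : set R := `]M%:R - m.+1%:R, M%:R - m%:R].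

Lemma measurable_layer M m : measurable (layer M m).
Proof. exact: measurable_itv. Qed.

Definition layer_sum (M : nat) (w : T) : \bar R :=
  (\sum_(0 <= m <oo) (expR (M%:R - m%:R))%:E * count (layer M m) w)%E.

Lemma layer_sum_ge0 M w : (0 <= layer_sum M w)%E.
Proof.
by apply: nneseries_ge0 => m _ _; rewrite mule_ge0 ?lee_fin ?expR_ge0 ?count_ge0.
Qed.

Lemma measurable_layer_sum M : measurable_fun setT (layer_sum M).
Proof.
apply: ge0_emeasurable_sum => [m w _ _|m _].
  by rewrite mule_ge0 ?lee_fin ?expR_ge0 ?count_ge0.
by apply: measurable_funeM; apply: measurable_count; exact: measurable_layer.
Qed.

Lemma integral_count_layer M m :
  (\int[P]_w count (layer M m) w <= (alpha * expR (alpha * (m.+1%:R - M%:R)))%:E)%E.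
Proof.
have /andP[a0 _] := alpha01.
have [|r rE rle] := @exp_intensity_itv R alpha (M%:R - m.+1%:R) (M%:R - m%:R) a0.
  by rewrite ltrD2l ltrN2 ltr_nat.
rewrite (@poisson_mean _ _ _ P _ r).
- rewrite lee_fin (le_trans rle) // le_eqVlt; apply/orP; left; apply/eqP.
  have -> : M%:R - m%:R - (M%:R - m.+1%:R) = 1 :> R by rewrite -natr1; ring.
  by rewrite mulr1 mulNr -mulrN opprB.
- apply: measurable_count; exact: measurable_layer.
- by move=> w; exact: count_ge0.
- by rewrite -rE; apply: poissonE.1; exact: measurable_layer.
Qed.

(** The [m]-th term is at most a constant times [expR (- m)] times
    [expR (alpha * m)], a geometric sequence of ratio [expR (alpha - 1) < 1]. *)
Lemma integral_layer_sum M : (\int[P]_w layer_sum M w < +oo)%E.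
Proof.
have /andP[a0 a1] := alpha01.
rewrite integral_nneseries //; last 2 first.
- by move=> m; apply: measurable_funeM; apply: measurable_count; exact: measurable_layer.
- by move=> m w _; rewrite mule_ge0 ?lee_fin ?expR_ge0 ?count_ge0.
pose c := alpha * expR (alpha + (1 - alpha) * M%:R).
pose q := expR (alpha - 1).
have q1 : `|q| < 1 by rewrite ger0_norm ?expR_ge0 // expR_lt1 subr_lt0.
apply: (@le_lt_trans _ _ (\sum_(0 <= m <oo) (geometric c q m)%:E)%E); last first.
  by rewrite (nneseries_EFin (cvg_geometric_series q1)) ltry.
apply: lee_nneseries => [m _ _|m _].
  by apply: integral_ge0 => w _; rewrite mule_ge0 ?lee_fin ?expR_ge0 ?count_ge0.
rewrite ge0_integralZl_EFin ?expR_ge0 //; last first.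
  by apply: measurable_count; exact: measurable_layer.
apply: le_trans (lee_wpmul2l _ (integral_count_layer M m)) _.
  by rewrite lee_fin expR_ge0.
rewrite -EFinM lee_fin /= /c /q -expRM_natl mulrCA -!mulrA -!expRD.
rewrite le_eqVlt; apply/orP; left; apply/eqP; congr (_ * expR _).
by rewrite -natr1; ring.
Qed.

Lemma sum_exp_le_layer_sum M w : (forall i, E i w <= M%:R) ->
  (\sum_(0 <= i <oo) (expR (E i w))%:E <= layer_sum M w)%E.
Proof.
move=> EM; rewrite /layer_sum.
have u0 m i : (0 <= (expR (M%:R - m%:R))%:E * \d_(E i w) (layer M m) :> \bar R)%E.
  by rewrite mule_ge0 // lee_fin expR_ge0.
rewrite [leRHS](eq_eseriesr (g := fun m => (\sum_(0 <= i <oo)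
    (expR (M%:R - m%:R))%:E * \d_(E i w) (layer M m))%E)); last first.
  by move=> m _; rewrite nneseriesZl.
rewrite [leRHS]nneseries_interchange //; apply: lee_nneseries => [i _ _|i _].
  by rewrite lee_fin expR_ge0.
(* The layer that contains the point E i w. *)
pose m := Num.trunc (M%:R - E i w).
have /andP[m1 m2] : m%:R <= M%:R - E i w < m.+1%:R by rewrite truncn_itv ?subr_ge0.
apply: le_trans (nneseries_ge_term m _) => [|k]; last exact: u0.
rewrite diracE mem_set ?mule1 ?lee_fin ?ler_expR; first by lra.
by rewrite /layer /= in_itv /=; apply/andP; split; lra.
Qed.

(** There is no deterministic upper bound for the largest point [E 0 w], so the
    layer sums are taken for all integers [M] simultaneously. *)
Lemma ae_summable_exp : {ae P, forall w, (forall i, E i.+1 w < E i w) ->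
  cvgn (series (fun i => expR (E i w)))}.
Proof.
have : {ae P, forall w, forall M, layer_sum M w \is a fin_num}.
  apply/ae_foralln => M.
  apply: (filterS (P := fun w => setT w -> layer_sum M w \is a fin_num)).
    by move=> w; exact.
  apply: integrable_ae => //; apply/integrableP.
  split; first exact: measurable_layer_sum.
  under eq_integral do rewrite gee0_abs ?layer_sum_ge0 //.
  exact: integral_layer_sum.
apply: filterS => w finw E_decr; apply: nneseries_cvgn => [i|]; first exact: expR_ge0.
pose M := (Num.trunc `|E 0%N w|).+1.
apply: (@le_lt_trans _ _ (layer_sum M w)).
  apply: sum_exp_le_layer_sum => i; apply: (@le_trans _ _ (E 0%N w)).
    exact: (decr_nonincr (E := fun i => E i w)).
  by apply: le_trans (ler_norm _) _; rewrite ltW // /M truncnS_gt.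
by have := finw M; rewrite ge0_fin_numE ?layer_sum_ge0.
Qed.

End summability.

(** * Convergence of the spectra *)

Theorem proposition4p1 (R : realType) (d : measure_display)
    (T : measurableType d) (P : probability T R) (alpha tau0 : R)
    (E : nat -> {RV P >-> R})
    (halpha : 0 < alpha < 1) (htau0 : 0 < tau0)
    (hE : poisson_point_process E (exp_intensity alpha))
    (hlabel : {ae P, forall w, forall i, E i.+1 w < E i w}) :
  {ae P, forall w,
    let Ew := fun i => E i w in
    let x := waiting_time tau0 Ew in
    exists (lamE : R -> seq R) (lam : nat -> R),
      [/\ forall e, increasing_spectrum
                      (trap_matrix x (count_above Ew e)) (lamE e),
          lam 0%N = 0,
          {homo lam : i j / (i < j)%N >-> i < j},
          complex_limit_spectrum x = range (fun j => (lam j)%:C%C) &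
          vague_cvg_halfline (ninfty_nbhs R)
            (fun e => finite_point_measure (lamE e)) (point_measure lam)]}.
Proof.
apply: filterS2 hlabel (ae_summable_exp halpha hE) => w E_decr /(_ E_decr) Esum.
pose Ew i := E i w; pose x := waiting_time tau0 Ew.
have x_gt0 i : 0 < x i by rewrite mulr_gt0 ?expR_gt0.
have x_incr : {homo x : i j / (i < j)%N >-> i < j}.
  move=> i j ij; rewrite ltr_pM2l // ltr_expR ltrN2.
  exact: le_lt_trans (decr_nonincr E_decr ij) (E_decr i).
have x_summable : cvgn (series (fun i => (x i)^-1)).
  have -> : series (fun i => (x i)^-1)
      = (fun n => tau0^-1 * series (fun i => expR (Ew i)) n).
    apply/funext => n; rewrite /series /= mulr_sumr; apply: eq_bigr => i _.
    by rewrite /x /waiting_time invfM expRN invrK.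
  by apply: is_cvgMr.
have E_unbounded B : exists k, Ew k < B.
  have [k] := poles_unbounded x_gt0 x_summable (tau0 * expR (- B)).
  by rewrite ltr_pM2l // ltr_expR ltrN2; exists k.
exists (fun e => mkseq (trap_level x (count_above Ew e)) (count_above Ew e)).
exists (limit_level x); split.
- by move=> e; exact: trap_spectrumP.
- exact: limit_level0.
- exact: limit_level_lt.
- exact: complex_limit_spectrumE.
- by apply: vague_cvg_trap_spectrum => //; exact: count_above_cvg.
Qed.
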